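(* Let $\mathfrak C$ be a left cancellative small category. (i) $I_l\ltimes\Omega$ is Hausdorff if and only if for all $s\in I_l$ there exists a (possibly empty) finite subset $\{e_1,\dots,e_n\}\subseteq\mathcal J$ with $\{x\in\mathrm{dom}(s):s(x)=x\}=\bigcup_{i=1}^ne_i$. (ii) $I_l\,\bar\ltimes\,\Omega$ is Hausdorff if and only if for all $s\in I_l$ there exists a (possibly empty) finite subset $\{\varepsilon_1,\dots,\varepsilon_n\}\subseteq\bar{\mathcal J}$ with $\{x\in\mathrm{dom}(s):s(x)=x\}=\bigcup_{i=1}^n\varepsilon_i$.
   Context: $\mathfrak C$ denotes the set of morphisms, $\mathfrak C^0\subseteq\mathfrak C$ the identity morphisms, $\mathfrak d,\mathfrak t$ domain and target; $cd$ is defined iff $\mathfrak d(c)=\mathfrak t(d)$; left cancellative means $cx=cy\Rightarrow x=y$. Each $c\in\mathfrak C$ gives the partial bijection $\mathfrak d(c)\mathfrak C\to c\mathfrak C$, $x\mapsto cx$; $I_l$ is the smallest semigroup of partial bijections of $\mathfrak C$ containing these and closed under inverses; $\mathcal J=\{\mathrm{dom}(s):s\in I_l\}$ is its semilattice of idempotents (product = intersection). $\bar{\mathcal J}$ is the set of subsets $\varepsilon=e\setminus\bigcup_{i=1}^nf_i$ of $\mathfrak C$ with $e,f_1,\dots,f_n\in\mathcal J$, $f_i\subseteq e$. $\widehat{\mathcal J}$ is the space of non-zero multiplicative maps $\chi:\mathcal J\to\{0,1\}$ with $\chi(\emptyset)=0$ if $\emptyset\in\mathcal J$ (pointwise convergence).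 $\Omega\subseteq\widehat{\mathcal J}$ consists of those $\chi$ such that whenever $e=\bigcup_{i=1}^nf_i$ ($e,f_i\in\mathcal J$) and $\chi(e)=1$, then $\chi(f_i)=1$ for some $i$. For $\chi\in\Omega$ and $\varepsilon=e\setminus\bigcup f_i\in\bar{\mathcal J}$, put $\chi(\varepsilon)=1$ iff $\chi(e)=1$ and $\chi(f_i)=0$ for all $i$, and $\chi(\varepsilon)=0$ otherwise (well defined). $s\in I_l$ acts by $\chi\mapsto s.\chi=\chi(s^{-1}\cdot s)$ from $\Omega(s^{-1}s)=\{\chi\in\Omega:\chi(s^{-1}s)=1\}$ onto $\Omega(ss^{-1})$. $I_l\ltimes\Omega$ is the quotient of $\{(s,\chi)\in I_l\times\Omega:\chi(s^{-1}s)=1\}$ by $(s,\chi)\sim(t,\psi)$ iff $\chi=\psi$ and $se=te$ for some $e\in\mathcal J$ with $\chi(e)=1$; $I_l\,\bar\ltimes\,\Omega$ is the quotient by $(s,\chi)\bar\sim(t,\psi)$ iff $\chi=\psi$ and $s\varepsilon=t\varepsilon$ for some $\varepsilon\in\bar{\mathcal J}$ with $\chi(\varepsilon)=1$ (here $se$, $s\varepsilon$ denote restrictions as partial bijections). Both are groupoids with source $\chi$, range $s.\chi$, $[s,t.\chi][t,\chi]=[st,\chi]$, $[s,\chi]^{-1}=[s^{-1},s.\chi]$; in both cases the topology is such that the images of $\{s\}\times\Omega(s^{-1}s)$ are open and mapped homeomorphically onto $\Omega(s^{-1}s)$ by the source map. *)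

(* Defs.v *)
From HB Require Import structures.
From mathcomp Require Import all_boot.
From mathcomp Require Import generic_quotient.
From mathcomp Require Import all_classical topology.

Set Implicit Arguments.
Unset Strict Implicit.
Unset Printing Implicit Defensive.

Local Open Scope classical_set_scope.
Local Open Scope relation_scope.
Local Open Scope quotient_scope.

(* A small category presented by its set of morphisms.  The identities are the
   morphisms in the images of [src] and [tgt]; [ccomp c d] is the composite
   "d, then c", and its value is irrelevant unless [src c = tgt d]. *)
Record category := Category {
  mor :> Type;
  src : mor -> mor;
  tgt : mor -> mor;
  ccomp : mor -> mor -> mor;
  src_src : forall c, src (src c) = src c;
  tgt_src : forall c, tgt (src c) = src c;
  src_tgt : forall c, src (tgt c) = tgt c;
  tgt_tgt : forall c, tgt (tgt c) = tgt c;
  ccomp_src : forall c, ccomp c (src c) = c;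
  ccomp_tgt : forall c, ccomp (tgt c) c = c;
  src_ccomp : forall c d, src c = tgt d -> src (ccomp c d) = src d;
  tgt_ccomp : forall c d, src c = tgt d -> tgt (ccomp c d) = tgt c;
  ccompA : forall b c d, src b = tgt c -> src c = tgt d ->
    ccomp b (ccomp c d) = ccomp (ccomp b c) d
}.

Definition left_cancellative (C : category) : Prop :=
  forall c x y : C, src c = tgt x -> src c = tgt y ->
    ccomp c x = ccomp c y -> x = y.

Record lcCategory := LcCategory {
  lc_cat :> category;
  lc_cancel : left_cancellative lc_cat
}.

(* Partial maps of X are represented by their graphs.  In [relation_scope],
   [s \; t] is the composite "t, then s" and [s^-1] is the converse. *)
Section PartialBijections.
Variable X : Type.
Implicit Types s t : set (X * X).

Definition partial_bijection s : Prop :=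
  (forall x y y', s (x, y) -> s (x, y') -> y = y') /\
  (forall x x' y, s (x, y) -> s (x', y) -> x = x').

Definition pdom s : set X := [set x | exists y, s (x, y)].

Definition prestr s (A : set X) : set (X * X) := [set p | s p /\ A p.1].

Definition pfix s : set X := [set x | s (x, x)].

Definition semigroup_with_inverses (S : set (set (X * X))) : Prop :=
  (forall s t, S s -> S t -> S (s \; t)) /\ (forall s, S s -> S s^-1).

Lemma partial_bijection_semigroup :
  semigroup_with_inverses [set s | partial_bijection s].
Proof.
split=> [s t [sf si] [tf ti]|s [sf si]]; split=> /=.
- move=> x y y' [z /= xz zy] [z' /= xz' zy'].
  by move: zy'; rewrite -(tf _ _ _ xz xz'); exact: sf.
- move=> x x' y [z /= xz zy] [z' /= xz' zy'].
  by move: xz'; rewrite -(si _ _ _ zy zy'); exact: ti.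
- by move=> x y y'; exact: si.
- by move=> x x' y; exact: sf.
Qed.

Lemma prestrI s A B : prestr s (A `&` B) = prestr (prestr s A) B.
Proof. by apply/seteqP; split=> p; rewrite /prestr/= => -[]; tauto. Qed.

Lemma prestrIr s A B : prestr s (A `&` B) = prestr (prestr s B) A.
Proof. by rewrite setIC prestrI. Qed.

End PartialBijections.

Section InverseHull.
Variable C : lcCategory.

(* The map d(c)C -> cC, x |-> cx; note d(c)C = {x | t(x) = d(c)}. *)
Definition lmul (c : C) : set (C * C) :=
  [set p | src c = tgt p.1 /\ p.2 = ccomp c p.1].

Definition Il : set (set (C * C)) :=
  smallest (@semigroup_with_inverses C) (range lmul).

Lemma Il_comp s t : Il s -> Il t -> Il (s \; t).
Proof. by move=> Is It S /[dup] HS [[SM _] _]; apply: SM; [exact: Is|exact: It]. Qed.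

Lemma Il_inv s : Il s -> Il s^-1.
Proof. by move=> Is S /[dup] HS [[_ SV] _]; apply: SV; exact: Is. Qed.

Lemma Il_partial_bijection s : Il s -> partial_bijection s.
Proof.
apply; split; first exact: partial_bijection_semigroup.
move=> _ [c _ <-]; split=> [x y y' [_ /= ->] [_ /= ->] //|x x' y [/= cx ->]].
by case=> /= cx'; exact: (@lc_cancel C c).
Qed.

Definition J : set (set C) := [set pdom s | s in Il].

Lemma J_pdom s : Il s -> J (pdom s).
Proof. by move=> Is; exists s. Qed.

Lemma J_setI e f : J e -> J f -> J (e `&` f).
Proof.
move=> [s Is <-] [t It <-].
exists ((s^-1 \; s) \; (t^-1 \; t)).
  by apply: Il_comp; (apply: Il_comp; first exact: Il_inv).
have [sf si] := Il_partial_bijection Is; have [tf ti] := Il_partial_bijection It.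
apply/seteqP; split=> [x [y [z /= [a /= xa za] [b /= zb _]]]|x [[y xy] [z xz]]].
  by rewrite -(ti _ _ _ xa za) in zb; split; [exists b|exists a].
by exists x; exists x; [exists z|exists y].
Qed.

Definition dom_J (s : Il) : J := exist (fun A => A \in J) _
    (mem_set (J_pdom (set_mem (valP s)))).

Definition meet_J (e f : J) : J :=
  exist (fun A => A \in J) _
    (mem_set (J_setI (set_mem (valP e)) (set_mem (valP f)))).

(* [eps_of e F eps] means that eps = e \ (f_1 u ... u f_n), where
   F = {f_1, ..., f_n}; n = 0 is allowed, so that J is contained in Jbar. *)
Definition eps_of (e : J) (F : set J) (eps : set C) : Prop :=
  [/\ finite_set F, forall f, F f -> val f `<=` val e &
      eps = val e `\` \bigcup_(f in F) val f].

Definition Jbar : set (set C) :=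
  [set eps | exists (e : J) (F : set J), eps_of e F eps].

Definition Jhat : set {ptws J -> bool} :=
  [set chi : {ptws J -> bool} | [/\ exists e, chi e,
                 forall e f, chi (meet_J e f) = chi e && chi f &
                 forall e, val e = set0 -> chi e = false]].

Definition Omega_set : set {ptws J -> bool} :=
  [set chi : {ptws J -> bool} | Jhat chi /\
     forall (e : J) (F : set J), finite_set F ->
       val e = \bigcup_(f in F) val f -> chi e -> exists2 f, F f & chi f].

Definition Omega : topologicalType := set_type Omega_set.

Definition ev (chi : Omega) (e : J) : bool := (val chi : J -> bool) e.

(* The extension of chi to Jbar; see [ev_barE] for the independence of the
   chosen presentation of eps. *)
Definition ev_bar (chi : Omega) (eps : set C) : bool :=
  `[< exists (e : J) (F : set J),
        [/\ eps_of e F eps, ev chi e & forall f, F f -> ev chi f = false] >].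

Implicit Types (chi : Omega) (e f : J).

Lemma ev_meet chi e f : ev chi (meet_J e f) = ev chi e && ev chi f.
Proof. by have [[_ chiM _] _] := set_mem (valP chi); exact: chiM. Qed.

Lemma ev_ex chi : exists e, ev chi e.
Proof. by have [[chiE _ _] _] := set_mem (valP chi). Qed.

Lemma ev_cover chi e (F : set J) : finite_set F ->
  val e = \bigcup_(f in F) val f -> ev chi e -> exists2 f, F f & ev chi f.
Proof. by have [_] := set_mem (valP chi); exact. Qed.

Lemma ev_sub chi e f : val e `<=` val f -> ev chi e -> ev chi f.
Proof.
move=> /setIidPl ef.
have {1}-> : e = meet_J e f by apply: val_inj.
by rewrite ev_meet => /andP[].
Qed.

Lemma ev_subcover chi e (F : set J) : finite_set F ->
  val e `<=` \bigcup_(f in F) val f -> ev chi e -> exists2 f, F f & ev chi f.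
Proof.
move=> finF eF chie.
have [||_ [f Ff <-]] := @ev_cover chi e (meet_J e @` F) _ _ chie.
- exact: finite_image.
- by rewrite bigcup_image -setI_bigcupr; apply/esym/setIidPl.
by rewrite ev_meet => /andP[_]; exists f.
Qed.

Lemma ev_bar_indep chi e e' (F F' : set J) eps :
    eps_of e F eps -> eps_of e' F' eps ->
    ev chi e -> (forall f, F f -> ev chi f = false) ->
  ev chi e' /\ (forall f, F' f -> ev chi f = false).
Proof.
move=> [finF Fe ->] [finF' Fe' E] chie chiF.
have chie' : ev chi e'.
  have [||f [->|Ff]] := @ev_subcover chi e (e' |` F) _ _ chie.
  - by rewrite finite_setU; split.
  - move=> x ex; have [[f Ff fx]|nFx] := pselect ((\bigcup_(f in F) val f) x).
      by exists f => //; right.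
    have : (val e `\` \bigcup_(f in F) val f) x by [].
    by rewrite E => -[e'x _]; exists e' => //; left.
  - by [].
  - by rewrite chiF.
split=> // f F'f; apply/negbTE/negP => chif.
have [||g Fg] := @ev_subcover chi (meet_J e f) F finF.
- move=> x /= [ex fx].
  have [//|nFx] := pselect ((\bigcup_(f in F) val f) x).
  have : (val e `\` \bigcup_(f in F) val f) x by [].
  by rewrite E => -[_ []]; exists f.
- by rewrite ev_meet chie.
- by rewrite chiF.
Qed.

Lemma ev_barE chi e (F : set J) eps : eps_of e F eps ->
  ev_bar chi eps <-> ev chi e /\ (forall f, F f -> ev chi f = false).
Proof.
move=> epsE; split=> [/asboolP[e' [F' [epsE' chie' chiF']]]|[chie chiF]].
  exact: ev_bar_indep epsE' epsE chie' chiF'.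
by apply/asboolP; exists e, F.
Qed.

Lemma ev_bar_Jbar chi eps : ev_bar chi eps -> Jbar eps.
Proof. by move=> /asboolP[e [F [? _ _]]]; exists e, F. Qed.

Lemma eps_of_J e : eps_of e set0 (val e).
Proof. by split=> //; rewrite bigcup_set0 setD0. Qed.

Lemma ev_bar_ex chi : exists eps, ev_bar chi eps.
Proof.
by have [e chie] := ev_ex chi; exists (val e); apply/(ev_barE _ (eps_of_J e)).
Qed.

Lemma ev_bar_setI chi eps eta :
  ev_bar chi eps -> ev_bar chi eta -> ev_bar chi (eps `&` eta).
Proof.
move=> /asboolP[e [F [[finF Fe ->] chie chiF]]].
move=> /asboolP[e' [F' [[finF' Fe' ->] chie' chiF']]].
apply/asboolP; exists (meet_J e e'), (meet_J (meet_J e e') @` (F `|` F')).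
split; last 2 first.
- by rewrite ev_meet chie.
- move=> _ [f Ff <-]; rewrite !ev_meet.
  by case: Ff => [/chiF|/chiF'] ->; rewrite andbF.
split.
- by apply: finite_image; rewrite finite_setU; split.
- by move=> _ [f _ <-] x [].
- rewrite bigcup_image -setI_bigcupr bigcup_setU /=.
  by apply/seteqP; split=> x /=; rewrite /setI/setD/setU/=; tauto.
Qed.

(* The set {(s, chi) | chi(s^-1 s) = 1}, where s^-1 s is the identity of dom(s);
   I_l carries the discrete topology. *)
Definition action_set : set (discrete_topology Il * Omega) :=
  [set p | ev p.2 (dom_J p.1)].

Definition action_dom : topologicalType := set_type action_set.

Definition bis (p : action_dom) : set (C * C) := val (val p).1.

Definition pt (p : action_dom) : Omega := (val p).2.

Definition germ (p q : action_dom) : bool :=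
  `[< pt p = pt q /\ exists e, ev (pt p) e /\
        prestr (bis p) (val e) = prestr (bis q) (val e) >].

Definition germ_bar (p q : action_dom) : bool :=
  `[< pt p = pt q /\ exists eps, [/\ Jbar eps, ev_bar (pt p) eps &
        prestr (bis p) eps = prestr (bis q) eps] >].

Lemma germ_refl : reflexive germ.
Proof.
by move=> p; apply/asboolP; split=> //; have [e] := ev_ex (pt p); exists e.
Qed.

Lemma germ_sym : symmetric germ.
Proof.
by move=> p q; apply/asboolP/asboolP => -[E [e [chie pq]]]; split=> //;
  exists e; rewrite -E pq.
Qed.

Lemma germ_trans : transitive germ.
Proof.
move=> q p r /asboolP[pq [e [ee Ee]]] /asboolP[qr [f [ff Ef]]]; apply/asboolP.
split; first by rewrite pq.
exists (meet_J e f); split; first by rewrite ev_meet ee pq.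
by rewrite /= prestrI Ee -prestrI prestrIr Ef -prestrIr.
Qed.

Lemma germ_bar_refl : reflexive germ_bar.
Proof.
move=> p; apply/asboolP; split=> //; have [e pe] := ev_bar_ex (pt p).
by exists e; split=> //; exact: ev_bar_Jbar pe.
Qed.

Lemma germ_bar_sym : symmetric germ_bar.
Proof.
by move=> p q; apply/asboolP/asboolP => -[E [e [? chie pq]]]; split=> //;
  exists e; rewrite -E pq.
Qed.

Lemma germ_bar_trans : transitive germ_bar.
Proof.
move=> q p r /asboolP[pq [e [_ ee Ee]]] /asboolP[qr [f [_ ff Ef]]].
apply/asboolP; split; first by rewrite pq.
have ef : ev_bar (pt p) (e `&` f) by apply: ev_bar_setI; rewrite ?pq // -pq.
exists (e `&` f); split=> //; first exact: ev_bar_Jbar ef.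
by rewrite prestrI Ee -prestrI prestrIr Ef -prestrIr.
Qed.

Canonical germ_equiv := EquivRel germ germ_refl germ_sym germ_trans.

Canonical germ_bar_equiv :=
  EquivRel germ_bar germ_bar_refl germ_bar_sym germ_bar_trans.

Definition groupoid_of (r : equiv_rel action_dom) : topologicalType :=
  quotient_topology {eq_quot r}.

Definition source (r : equiv_rel action_dom) (g : groupoid_of r) : Omega :=
  pt (repr g).

Definition Omega_dom (s : Il) : set Omega := [set chi | ev chi (dom_J s)].

Definition bisection (r : equiv_rel action_dom) (s : Il) :
  set (groupoid_of r) := \pi_(groupoid_of r) @` [set p | (val p).1 = s].

Lemma clopen_ev e : clopen [set chi : Omega | ev chi e].
Proof.
have cont : continuous (fun chi : Omega => ev chi e).
  move=> chi; apply: (@continuous_comp _ _ _ (@set_val _ Omega_set)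
    (@proj J (fun=> bool) e)).
    exact: initial_continuous.
  exact: proj_continuous.
apply: (@preimage_clopen _ _ (fun chi => ev chi e) [set b | b]) => //.
by split; [exact: discrete_open|exact: discrete_closed].
Qed.

Lemma open_ev_bar eps : open [set chi : Omega | ev_bar chi eps].
Proof.
have [[e [F epsE]]|none] := pselect (Jbar eps); last first.
  rewrite (_ : [set _ | _] = set0); first exact: open0.
  by apply/seteqP; split=> // chi /= /ev_bar_Jbar.
rewrite (_ : [set _ | _] = [set chi | ev chi e] `&`
    ~` \bigcup_(f in F) [set chi | ev chi f]).
  apply: openI; first by case: (clopen_ev e).
  apply: closed_openC; apply: closed_bigcup; first by case: epsE.
  by move=> f _; case: (clopen_ev f).
apply/seteqP; split=> chi /=.
  by move=> /(ev_barE _ epsE)[? chiF]; split=> // -[f /chiF /= ->].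
move=> [chie chiF]; apply/(ev_barE _ epsE); split=> // f Ff.
by apply/negbTE/negP => chif; apply: chiF; exists f.
Qed.

Lemma action_openP (W : set action_dom) :
  open W <-> forall p, W p -> exists V : set Omega, [/\ open V, V (pt p) &
    forall q, (val q).1 = (val p).1 -> V (pt q) -> W q].
Proof.
split.
- move=> [W0 oW0 <-] p W0p.
  have : nbhs (val p) W0 by exact: open_nbhs_nbhs.
  move=> [[A B] /= [/nbhs_singleton Ap nB] AB].
  exists (interior B); split=> //; first exact: open_interior.
  move=> q qp /interior_subset Bq; apply: AB; split=> //=.
  by rewrite -[set_val q]/(val q) qp.
- move=> H; rewrite openE => p /H[V [oV Vp VW]].
  have cont : {for p, continuous (@set_val _ action_set)}.
    exact: initial_continuous.
  have : nbhs (val p) ([set (val p).1] `*` V).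
    exists ([set (val p).1], V) => //; split=> /=.
      by apply: open_nbhs_nbhs; split=> //; exact: discrete_open.
    exact: open_nbhs_nbhs.
  move=> /cont; apply: (@filterS _ (nbhs p)) => q [/= qp Vq]; exact: VW.
Qed.

Section Topology.
Variable r : equiv_rel action_dom.
Hypothesis r_pt : forall p q, r p q -> pt p = pt q.
Hypothesis r_open : forall p q, r p q -> exists V : set Omega,
  [/\ open V, V (pt p) & forall p' q', (val p').1 = (val p).1 ->
    (val q').1 = (val q).1 -> pt p' = pt q' -> V (pt p') -> r p' q'].

Lemma pi_eqP (p q : action_dom) :
  \pi_(groupoid_of r) p = \pi_(groupoid_of r) q <-> r p q.
Proof. by split=> [/eqmodP|?]; last exact/eqmodP. Qed.

Lemma source_pi p : source (\pi_(groupoid_of r) p) = pt p.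
Proof. by rewrite /source; apply: r_pt; apply/pi_eqP; rewrite reprK. Qed.

Lemma pi_open (W : set action_dom) :
  open W -> open (\pi_(groupoid_of r) @` W).
Proof.
move=> oW; apply/action_openP => q [p Wp /pi_eqP rpq].
have [V [oV Vp VW]] := (action_openP W).1 oW p Wp.
have [U [oU Up Ur]] := r_open rpq; have E := r_pt rpq.
exists (V `&` U `&` [set chi | ev chi (dom_J (val p).1)]); split.
- by apply: openI; [exact: openI|case: (clopen_ev (dom_J (val p).1))].
- by rewrite -E; split=> //; exact: set_mem (valP p).
move=> q' q'q [[Vq' Uq'] domq'].
pose p' : action_dom := exist (fun x => x \in action_set) ((val p).1, pt q')
  (mem_set domq').
exists p'; first exact: VW.
by apply/pi_eqP; apply: Ur.
Qed.

Lemma groupoid_of_topology :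
  [/\ continuous (@source r),
      (forall W, open W -> open (@source r @` W)) &
      forall s : Il, [/\ open (@bisection r s),
        {in @bisection r s &, injective (@source r)} &
        @source r @` @bisection r s = Omega_dom s]].
Proof.
split.
- apply/quotient_continuous; apply/continuousP => V oV; apply/action_openP.
  move=> p /= Vp; exists V; split=> //; first by move: Vp; rewrite /= source_pi.
  by move=> q _; rewrite /preimage /= source_pi.
- move=> W oW; rewrite openE => _ [g Wg <-].
  have := (action_openP _).1 oW (repr g); rewrite /= reprK => /(_ Wg).
  move=> [V [oV Vp VW]]; rewrite /interior.
  set s := (val (repr g)).1.
  apply: (@filterS _ _ _ (V `&` [set chi | ev chi (dom_J s)])).
    move=> chi [Vchi dchi].
    pose p : action_dom := exist (fun x => x \in action_set) (s, chi)
      (mem_set dchi).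
    by exists (\pi_(groupoid_of r) p); [exact: VW|rewrite source_pi].
  apply: open_nbhs_nbhs; split.
    by apply: openI => //; case: (clopen_ev (dom_J s)).
  by split=> //; exact: set_mem (valP (repr g)).
- move=> s; split.
  + apply: pi_open; apply/action_openP => p ps; exists setT; split=> //.
      exact: openT.
    by move=> q qp _; rewrite /= qp.
  + move=> _ _ /set_mem[p ps <-] /set_mem[q qs <-]; rewrite !source_pi => pq.
    by congr \pi; apply: val_inj; apply: injective_projections; rewrite ?ps ?qs.
  + apply/seteqP; split=> [_ [_ [p ps <-] <-]|chi dchi].
      by rewrite source_pi -ps; exact: set_mem (valP p).
    pose p : action_dom := exist (fun x => x \in action_set) (s, chi)
      (mem_set dchi).
    exists (\pi_(groupoid_of r) p); last by rewrite source_pi.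
    by exists p.
Qed.

End Topology.

(* The spaces of arrows of the two transformation groupoids, with the quotient
   topology; Hausdorffness does not involve the groupoid operations. *)
Definition groupoid : topologicalType := groupoid_of germ_equiv.

Definition groupoid_bar : topologicalType := groupoid_of germ_bar_equiv.

(* The quotient topology is the topology for which the images of the sets
   {s} x Omega(s^-1 s) are open and mapped homeomorphically onto
   Omega(s^-1 s) by the source map. *)
Lemma groupoid_topology :
  [/\ continuous (@source germ_equiv),
      (forall W, open W -> open (@source germ_equiv @` W)) &
      forall s : Il, [/\ open (@bisection germ_equiv s),
        {in @bisection germ_equiv s &, injective (@source germ_equiv)} &
        @source germ_equiv @` @bisection germ_equiv s = Omega_dom s]].
Proof.
apply: groupoid_of_topology => [p q /asboolP[]//|].
move=> p q /asboolP[_ [e [pe E]]]; exists [set chi | ev chi e]; split=> //.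
  by case: (clopen_ev e).
move=> p' q' pp qq pq pe'; apply/asboolP; split=> //; exists e; split=> //.
by rewrite /bis pp qq.
Qed.

Lemma groupoid_bar_topology :
  [/\ continuous (@source germ_bar_equiv),
      (forall W, open W -> open (@source germ_bar_equiv @` W)) &
      forall s : Il, [/\ open (@bisection germ_bar_equiv s),
        {in @bisection germ_bar_equiv s &, injective (@source germ_bar_equiv)} &
        @source germ_bar_equiv @` @bisection germ_bar_equiv s = Omega_dom s]].
Proof.
apply: groupoid_of_topology => [p q /asboolP[]//|].
move=> p q /asboolP[_ [e [Je pe E]]]; exists [set chi | ev_bar chi e]; split=> //.
  exact: open_ev_bar.
move=> p' q' pp qq pq pe'; apply/asboolP; split=> //; exists e; split=> //.
by rewrite /bis pp qq.
Qed.

End InverseHull.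

(* Main.v *)
Require Import Defs.
From HB Require Import structures.
From mathcomp Require Import all_boot generic_quotient.
From mathcomp Require Import all_classical topology.

Set Implicit Arguments.
Unset Strict Implicit.
Unset Printing Implicit Defensive.

Local Open Scope classical_set_scope.

(** Say that a character chi charges a set k when chi(k) = 1.  Both statements
    are instances of one argument, run for a family K of subsets of C between J
    and Jbar that is closed under intersection with members of J, and for the
    equivalence relation r that identifies two arrows over the same character
    when their partial bijections coincide on some member of K charged by it.

    The germs of s and t at chi coincide exactly when chi charges some k in K
    contained in the fixed point set of t^-1 s ([rel_pfix]).

    If that fixed point set is a finite union of members of K, a character
    charging such a k charges one of these finitely many members
    ([ev_bar_subcover]), so equality of germs is a clopen condition on chi.  Over
    the characters violating it the bisections of s and t are disjoint, which
    separates distinct germs over the same character; germs over distinct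
    characters are separated in Omega ([hausdorff_of_pfix]).

    Conversely, if the groupoid is Hausdorff, the characters at which the germs
    of s and s^-1 s coincide form a closed subset of the compact set of
    characters charging dom(s) ([closed_rel_arrow_at], [compact_ev]).  It is
    covered by the open sets {chi | chi(k) = 1} for k in K contained in the fixed
    point set of s; a finite subcover yields finitely many such k.  They exhaust
    the fixed points: if s(x) = x then s fixes xC pointwise since I_l commutes
    with right multiplication ([Il_ccompr]), and xC is in J, so the character of
    the point x, e |-> [x in e], belongs to the closed set and charges one of the
    chosen k, i.e. x is in k ([pfix_of_hausdorff]). *)

(** The covering form of compactness, for a space that need not be pointed. *)
Lemma compact_finite_subcover (X : topologicalType) (A : set X) I (D : set I)
    (U : I -> set X) : compact A -> (forall i, D i -> open (U i)) ->
    A `<=` \bigcup_(i in D) U i ->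
  exists E, [/\ finite_set E, E `<=` D & A `<=` \bigcup_(i in E) U i].
Proof.
move=> cA oU AU.
(* Near covering along the filter of all large enough finite subsets of D. *)
pose B (E0 : set I) : set (set I) := [set E | E0 `<=` E].
pose Dfin : set (set I) := [set E | finite_set E /\ E `<=` D].
pose F := filter_from Dfin (fun E0 => Dfin `&` B E0).
have FF : Filter F.
  apply: filter_from_filter; first by exists set0; split.
  move=> E1 E2 [f1 d1] [f2 d2]; exists (E1 `|` E2).
    by split; [rewrite finite_setU|rewrite subUset].
  by move=> E [DE]; rewrite /B /= subUset => -[? ?].
have cov := (compact_near_coveringP A).1 cA (set I) F
  (fun E x => (\bigcup_(i in E) U i) x) FF.
have [x Ax|E [fE dE]] := cov; last first.
  by move=> /(_ E) AE; exists E; split=> //; apply: AE; split=> //; split.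
have [i Di Uix] := AU x Ax.
exists (U i, Dfin `&` B [set i]).
  split=> /=; first by apply: open_nbhs_nbhs; split=> //; exact: oU.
  by exists [set i] => //; split; [exact: finite_set1|move=> _ ->].
by move=> [y E] /= [Uiy [_ iE]]; exists i => //; exact: iE.
Qed.

(** * Characters of J *)

Section Characters.
Variable C : lcCategory.
Implicit Types (chi : Omega C) (x : C).

(** The right ideal xC generated by x. *)
Definition principal x : set C := [set y | exists2 z, src x = tgt z & y = ccomp x z].

Lemma J_principal x : @J C (principal x).
Proof.
exists (lmul x)^-1%relation.
  by apply: Il_inv => S [_]; apply; exists x.
by apply/seteqP; split=> y /= [z]; [move=> [? ?]|move=> *]; exists z.
Qed.

(** Elements of I_l commute with right multiplication. *)
Lemma Il_ccompr (s : set (C * C)) x y z :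
  Il s -> s (x, y) -> src x = tgt z -> s (ccomp x z, ccomp y z).
Proof.
(* The equality of domains makes the property stable under composition. *)
pose P (s : set (C * C)) := forall x y, s (x, y) -> src x = src y /\
  forall z, src x = tgt z -> s (ccomp x z, ccomp y z).
suff IP s' : Il s' -> P s' by move=> /IP/[apply]-[_]; apply.
apply; split; first split=> [s1 s2 P1 P2|s1 P1] a b /=.
- move=> [c /= /P2[ac h2] /P1[cb h1]]; rewrite ac cb; split=> // w bw.
  by exists (ccomp c w) => /=; [apply: h2; rewrite ac cb|apply: h1; rewrite cb].
- by move=> /P1[ba h]; split=> // w aw; apply: h; rewrite ba.
- move=> _ [c _ <-] a b [/= ca ->]; rewrite src_ccomp //; split=> // w aw.
  by split; rewrite /= ?tgt_ccomp// ccompA.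
Qed.

Lemma pfix_principal (s : set (C * C)) x : Il s -> pfix s x ->
  principal x `<=` pfix s.
Proof. by move=> Is sx y [z xz ->]; exact: Il_ccompr. Qed.

Lemma mem_principal x : principal x x.
Proof. by exists (src x); rewrite ?tgt_src ?ccomp_src. Qed.

Lemma Omega_point x : @Omega_set C (fun e => `[< val e x >]).
Proof.
split; first split.
- exists (exist (fun A => A \in @J C) _ (mem_set (J_principal x))).
  by apply/asboolP; exact: mem_principal.
- by move=> e f; apply/asboolP/andP => -[/asboolP ex /asboolP fx].
- by move=> e e0; apply/asboolP; rewrite e0.
- move=> e F _ -> /asboolP[f Ff fx]; exists f => //; exact/asboolP.
Qed.

(** The character e |-> [x in e] of the point x. *)
Definition point_char x : Omega C :=
  exist (fun phi => phi \in @Omega_set C) _ (mem_set (Omega_point x)).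

Lemma ev_point_char x e : ev (point_char x) e <-> val e x.
Proof. by split=> [/asboolP|?] //; apply/asboolP. Qed.

Lemma ev_bar_point_char x eps : Jbar eps -> ev_bar (point_char x) eps <-> eps x.
Proof.
move=> [e [F epsE]]; have [_ _ E] := epsE.
split=> [/(ev_barE _ epsE)[/ev_point_char ex Fx]|].
  by rewrite E; split=> // -[f /Fx /negP nfx fx]; apply/nfx/ev_point_char.
rewrite E => -[ex Fx]; rewrite -E; apply/(ev_barE _ epsE); split.
  exact/ev_point_char.
by move=> f Ff; apply/negP => /ev_point_char fx; apply: Fx; exists f.
Qed.

Lemma J_Jbar : @J C `<=` @Jbar C.
Proof.
move=> e Je; exists (exist (fun A => A \in @J C) _ (mem_set Je)), set0.
exact: eps_of_J.
Qed.

Lemma ev_bar_J chi (e : @J C) : ev_bar chi (val e) <-> ev chi e.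
Proof. by split=> [/(ev_barE _ (eps_of_J e))[]|?] //; apply/(ev_barE _ (eps_of_J e)). Qed.

Lemma Jbar_setI eps eta : @Jbar C eps -> @Jbar C eta -> Jbar (eps `&` eta).
Proof.
move=> Jeps Jeta.
(* A point of the intersection gives a character that evaluates to 1 on it. *)
have [/set0P[x [ex fx]]|] := boolP (eps `&` eta != set0).
  by apply: (@ev_bar_Jbar _ (point_char x)); apply: ev_bar_setI;
    exact/ev_bar_point_char.
move=> /negPn/eqP ->; have [e _] := Jeps; exists e, [set e]; split=> //.
  by move=> _ ->.
by rewrite bigcup_set1 setDv.
Qed.

Lemma ev_bar_nonempty chi eps : ev_bar chi eps -> eps !=set0.
Proof.
move=> /asboolP[e [F [[finF _ ->] chie chiF]]]; apply/set0P/negP => /eqP E.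
have [|f /chiF ->//] := @ev_subcover _ chi e F finF _ chie.
by rewrite -setD_eq0.
Qed.

(** The filter on C generated by the members of Jbar charged by chi.  It decides
    every member of Jbar, see [ev_filterC]. *)
Definition ev_filter chi : set_system C :=
  filter_from [set eps | ev_bar chi eps] id.

Global Instance ev_filter_proper chi : ProperFilter (ev_filter chi).
Proof.
apply: filter_from_proper; last by move=> eps; exact: ev_bar_nonempty.
apply: filter_from_filter; first exact: ev_bar_ex.
by move=> eps eta ? ?; exists (eps `&` eta) => //; exact: ev_bar_setI.
Qed.

Lemma ev_filterC chi eps : Jbar eps -> ~ ev_bar chi eps -> ev_filter chi (~` eps).
Proof.
move=> [e [F epsE]]; have [finF Fe E] := epsE => nchi.
have [chie|nchie] := boolP (ev chi e).
  have [[f [Ff chif]]|nF] := pselect (exists f, F f /\ ev chi f).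
    exists (val f); first exact/ev_bar_J.
    by move=> x fx; rewrite E /= => -[_]; apply; exists f.
  exfalso; apply: nchi; apply/(ev_barE _ epsE); split=> // f Ff.
  by apply/negP => chif; apply: nF; exists f.
(* If chi(e) = 0, any g with chi(g) = 1 gives g \ e, disjoint from eps. *)
have [g chig] := ev_ex chi; exists (val g `\` val e).
  2: by move=> x [_ ?]; rewrite E => -[].
apply/asboolP; exists g, [set meet_J g e]; split=> //; last first.
  by move=> _ ->; rewrite ev_meet (negbTE nchie) andbF.
split=> //; first by move=> _ -> x [].
by rewrite bigcup_set1 /= setDIr setDv set0U.
Qed.

(** The defining property of Omega, extended from J to Jbar. *)
Lemma ev_bar_subcover chi eps (E : set (set C)) : finite_set E ->
    E `<=` @Jbar C -> eps `<=` \bigcup_(eta in E) eta -> ev_bar chi eps ->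
  exists2 eta, E eta & ev_bar chi eta.
Proof.
move=> finE JE epsE chieps; apply: contrapT => nE.
have FE : ev_filter chi (\bigcap_(eta in E) ~` eta).
  rewrite -[in X in \bigcap_(_ in X) _](fset_setK finE).
  apply: filter_bigI => eta; rewrite in_fset_set// inE => Eeta.
  by apply: ev_filterC; [exact: JE|move=> ?; apply: nE; exists eta].
have Feps : ev_filter chi eps by exists eps.
have /filter_ex[x [ex nx]] : ev_filter chi (eps `&` \bigcap_(eta in E) ~` eta).
  exact: filterI.
by have [eta Eeta etax] := epsE _ ex; apply: nx etax.
Qed.

Lemma closed_ev_bar eps : Jbar eps -> closed [set chi : Omega C | ev_bar chi eps].
Proof.
move=> [e [F epsE]].
rewrite (_ : [set _ | _] = [set chi | ev chi e] `&`
    \bigcap_(f in F) ~` [set chi | ev chi f]).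
  apply: closedI; first by case: (clopen_ev e).
  by apply: closed_bigI => f _; apply: open_closedC; case: (clopen_ev f).
apply/seteqP; split=> chi /=.
  by move=> /(ev_barE _ epsE)[? chiF]; split=> // f /chiF /= ->.
move=> [chie chiF]; apply/(ev_barE _ epsE); split=> // f Ff.
by apply/negbTE/negP; exact: chiF.
Qed.

Lemma hausdorff_Omega : hausdorff_space (Omega C).
Proof.
rewrite open_hausdorff => chi psi neq.
have [e ne] : exists e, ev chi e != ev psi e.
  apply: contrapT => nex; move/eqP: neq; apply; apply: val_inj.
  apply/funext => e; apply/eqP/negPn/negP => ne; apply: nex.
  by exists e.
have [oe ce] := clopen_ev e.
wlog chie : chi psi {neq} ne / ev chi e.
  move=> wl; have [/wl|nchi] := boolP (ev chi e); first exact.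
  have [||[A B] /= [? ?] [? ? ?]] := wl psi chi; first by rewrite eq_sym.
    by case: (ev psi e) ne nchi => //; case: (ev chi e).
  by exists (B, A) => //; split=> //; rewrite setIC.
exists ([set chi | ev chi e], ~` [set chi | ev chi e]); rewrite /= ?inE.
  by split=> //=; move: ne; rewrite chie; case: (ev psi e).
by split=> //; [exact: closed_openC|rewrite setICr].
Qed.

Lemma closed_Omega_ev (e : @J C) :
  closed (@Omega_set C `&` [set chi : {ptws @J C -> bool} | (chi : @J C -> bool) e]).
Proof.
pose U (f : @J C) : set {ptws @J C -> bool} :=
  [set chi : {ptws @J C -> bool} | (chi : @J C -> bool) f].
have clU f : clopen (U f).
  apply: (@preimage_clopen _ _ (fun chi : {ptws @J C -> bool} => chi f) [set b | b]).
    by split; [exact: discrete_open|exact: discrete_closed].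
  exact: (@proj_continuous _ (fun=> bool) f).
have cU f : closed (U f) by case: (clU f).
have cUC f : closed (~` U f) by apply: open_closedC; case: (clU f).
(* Every condition defining the set bears on finitely many coordinates. *)
rewrite (_ : _ `&` _ = U e `&` (\bigcap_(p in [set: @J C * @J C])
      ((U (meet_J p.1 p.2) `&` (U p.1 `&` U p.2)) `|`
       (~` U (meet_J p.1 p.2) `&` (~` U p.1 `|` ~` U p.2))) `&`
    (\bigcap_(f in [set f : @J C | val f = set0]) ~` U f `&`
     \bigcap_(p in [set p : @J C * set (@J C) | finite_set p.2 /\
        val p.1 = \bigcup_(f in p.2) val f])
       (~` U p.1 `|` \bigcup_(f in p.2) U f)))); last first.
  apply/seteqP; split=> chi.
    move=> [[[_ chiM chi0] chiU] chie]; split=> //; split; [|split].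
    - move=> [f g] _ /=; rewrite /U /= chiM.
      by case: (chi f); case: (chi g) => /=; [left|right; split=> //; right|
        right; split=> //; left|right; split=> //; left].
    - by move=> f /chi0; rewrite /U /= => ->.
    - move=> [f F] /= [finF fF]; have [chif|] := pselect (chi f); last by left.
      by right; have [g Fg chig] := chiU f F finF fF chif; exists g.
  move=> [chie [chiM [chi0 chiU]]]; split=> //; split; first split.
  - by exists e.
  - move=> f g; have := chiM (f, g) I; rewrite /U /=.
    case: (chi (meet_J f g)) => -[[]//|] /=.
    + by move=> _ [-> ->].
    + by move=> [].
    + move=> [_ []] /negP/negbTE -> //; by rewrite andbF.
  - by move=> f /chi0 /negP/negbTE.
  - move=> f F finF fF chif; have [//|[g Fg chig]] := chiU (f, F) (conj finF fF).
    by exists g.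
apply: closedI => //; apply: closedI; [|apply: closedI].
- apply: closed_bigI => p _; apply: closedU; apply: closedI => //.
    exact: closedI.
  exact: closedU.
- by apply: closed_bigI => f _.
- apply: closed_bigI => p [finF _]; apply: closedU => //.
  exact: closed_bigcup.
Qed.

(** A closed subset of the compact space of all maps from J to {0, 1}, hence
    compact; a cluster point there gives one for the subspace topology. *)
Lemma compact_ev (e : @J C) : compact [set chi : Omega C | ev chi e].
Proof.
pose X : topologicalType := {ptws @J C -> bool}.
have cX : compact (@Omega_set C `&` [set chi : X | (chi : @J C -> bool) e]).
  apply: (@subclosed_compact X _ [set chi : X | forall f, [set: bool] (chi f)]) => //.
    exact: closed_Omega_ev.
  exact: (@tychonoff _ (fun=> bool) (fun=> setT) (fun=> bool_compact)).
move=> F PF Fe; pose v : Omega C -> X := @set_val _ (@Omega_set C).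
have PG : ProperFilter (v @ F) by exact: fmap_proper_filter.
have [|p [[Op pe] clp]] := cX _ PG.
  have : F [set chi : Omega C | ev chi e] by [].
  apply: (@filterS _ F) => chi chie; split; last exact: chie.
  exact: set_mem (valP chi).
exists (exist (fun phi => phi \in @Omega_set C) p (mem_set Op)); split=> //.
move=> A B FA [_ [[V oV <-] Vp VB]].
have [||_ [[chi Achi <-] Vchi]] := clp (v @` A) V.
- by apply: (@filterS _ F _ A) => // chi Achi; exists chi.
- exact: open_nbhs_nbhs.
- by exists chi; split=> //; apply: VB.
Qed.

End Characters.

(** * Groupoids of germs *)

Section Groupoids.
Local Open Scope quotient_scope.
Variable C : lcCategory.

(** The pair (s, chi) as an element of the domain of the action. *)
Definition arrow_at (s : @Il C) chi (H : ev chi (dom_J s)) : action_dom C :=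
  exist (fun p => p \in @action_set C) (s, chi) (mem_set H).

Variables (K : set (set C)) (r : equiv_rel (action_dom C)).
Hypothesis J_K : @J C `<=` K.
Hypothesis K_Jbar : K `<=` @Jbar C.
Hypothesis K_setI : forall k e, K k -> @J C e -> K (k `&` e).
Hypothesis rP : forall p q : action_dom C, r p q <-> pt p = pt q /\
  exists k, [/\ K k, ev_bar (pt p) k & prestr (bis p) k = prestr (bis q) k].

(** Members of K on which the two partial bijections agree may lie outside of
    their domains; intersecting with the domain brings them into the fixed point
    set of the composite below. *)
Lemma rel_pfix (p q : action_dom C) : r p q <-> pt p = pt q /\
  exists k, [/\ K k, ev_bar (pt p) k & k `<=` pfix ((bis q)^-1 \; bis p)%relation].
Proof.
have Ip : Il (bis p) by exact: set_mem (valP (val p).1).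
have Iq : Il (bis q) by exact: set_mem (valP (val q).1).
have [pf _] := Il_partial_bijection Ip; have [qf _] := Il_partial_bijection Iq.
split=> [/rP[pq [k [Kk chik E]]]|[pq [k [Kk chik kfix]]]].
  split=> //; exists (k `&` pdom (bis p)); split.
  - by apply: K_setI => //; exact: J_pdom.
  - apply: ev_bar_setI => //; apply/(ev_bar_J _ (dom_J (val p).1)).
    exact: set_mem (valP p).
  - move=> x [kx [y pxy]]; exists y => //=.
    have : prestr (bis p) k (x, y) by [].
    by rewrite E => -[].
apply/rP; split=> //; exists k; split=> //.
by apply/seteqP; split=> -[x y] [/= sxy kx]; split=> //=;
  have [z /= pz qz] := kfix _ kx; rewrite ?(pf _ _ _ sxy pz) ?(qf _ _ _ sxy qz).
Qed.

Lemma rel_arrow_at (s t : @Il C) chi (Hs : ev chi (dom_J s))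
    (Ht : ev chi (dom_J t)) : r (arrow_at Hs) (arrow_at Ht) <->
  exists k, [/\ K k, ev_bar chi k & k `<=` pfix ((val t)^-1 \; val s)%relation].
Proof. by split=> [/rel_pfix[]|?] //; apply/rel_pfix. Qed.

Lemma rel_pt (p q : action_dom C) : r p q -> pt p = pt q.
Proof. by move=> /rP[]. Qed.

Lemma rel_open (p q : action_dom C) : r p q -> exists V : set (Omega C),
  [/\ open V, V (pt p) & forall p' q', (val p').1 = (val p).1 ->
    (val q').1 = (val q).1 -> pt p' = pt q' -> V (pt p') -> r p' q'].
Proof.
move=> /rP[_ [k [Kk chik E]]]; exists [set chi | ev_bar chi k]; split=> //.
  exact: open_ev_bar.
by move=> p' q' pp qq pq chik'; apply/rP; split=> //; exists k; rewrite /bis pp qq.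
Qed.

Lemma hausdorff_of_pfix :
    (forall s : set (C * C), Il s -> exists E : set (set C),
      [/\ finite_set E, E `<=` K & pfix s = \bigcup_(e in E) e]) ->
  hausdorff_space (groupoid_of r).
Proof.
move=> fixE; rewrite open_hausdorff => g h; rewrite -(reprK g) -(reprK h).
move: (repr g) (repr h) => p q /eqP pi_neq {g h}.
have npq : ~ r p q by move=> /pi_eqP.
have [src_cont _ _] := groupoid_of_topology rel_pt rel_open.
have [E|/eqP neq] := pselect (pt p = pt q); last first.
  have := @hausdorff_Omega C; rewrite open_hausdorff => /(_ _ _ neq).
  move=> [[A B] /= [/set_mem Ap /set_mem Bq] [oA oB /eqP AB]].
  exists (@source C r @^-1` A, @source C r @^-1` B) => /=.
    by rewrite !inE /= !source_pi //; exact: rel_pt.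
  split; [exact: open_comp|exact: open_comp|].
  by rewrite -preimage_setI AB preimage_set0.
have Ip : Il (bis p) by exact: set_mem (valP (val p).1).
have Iq : Il (bis q) by exact: set_mem (valP (val q).1).
have [F [finF FK fixF]] := fixE _ (Il_comp (Il_inv Iq) Ip).
(* Off the clopen set of characters charging a member of F, no germ of one
   partial bijection equals a germ of the other. *)
pose V : set (Omega C) := ~` \bigcup_(k in F) [set chi | ev_bar chi k].
have oV : open V.
  apply: closed_openC; apply: closed_bigcup => // k Fk.
  exact/closed_ev_bar/K_Jbar/FK.
pose W (p : action_dom C) : set (action_dom C) := [set q | (val q).1 = (val p).1 /\ V (pt q)].
have oW p' : open (W p').
  apply/action_openP => q' [q'p Vq']; exists V; split=> //.
  by move=> q'' /= q''q' Vq''; split=> //=; rewrite q''q'.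
have Vp : V (pt p).
  move=> [k Fk chik]; apply: npq; apply/rel_pfix; split=> //.
  by exists k; split=> //; [exact: FK|rewrite fixF => x kx; exists k].
exists (\pi_(groupoid_of r) @` W p, \pi_(groupoid_of r) @` W q) => /=.
  by rewrite !inE; split; [exists p|exists q; rewrite // /W /= -E].
split; try exact: (pi_open rel_pt rel_open).
apply/eqP/seteqP; split=> // _ [[p' [p'p Vp'] <-] [q' [q'q Vq'] /pi_eqP qp']].
have [E' [k [Kk chik kfix]]] := (rel_pfix q' p').1 qp'.
apply: Vp'; rewrite -E'.
apply: (@ev_bar_subcover _ _ k F) => //; first by move=> l /FK /K_Jbar.
rewrite -fixF => x /kfix /= [y q'y p'y]; exists y; move: q'y p'y => /=;
  by rewrite /bis p'p q'q.
Qed.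

(** The displayed set consists of the characters at which the germs of s and t
    are defined and equal; the complement is open since unequal germs have
    disjoint neighborhoods, on which they remain unequal. *)
Lemma closed_rel_arrow_at (s t : @Il C) : hausdorff_space (groupoid_of r) ->
  closed [set chi | [/\ ev chi (dom_J s), ev chi (dom_J t) &
    exists k, [/\ K k, ev_bar chi k & k `<=` pfix ((val t)^-1 \; val s)%relation]]].
Proof.
rewrite open_hausdorff => hG; rewrite -[X in closed X]setCK; apply: open_closedC.
rewrite openE => chi /= nchi; rewrite /interior.
have [Hs|/negP Hs] := boolP (ev chi (dom_J s)); last first.
  apply: (@filterS _ _ _ (~` [set chi | ev chi (dom_J s)])); first by move=> ? ? [].
  by apply: open_nbhs_nbhs; split=> //; apply: closed_openC; case: (clopen_ev (dom_J s)).
have [Ht|/negP Ht] := boolP (ev chi (dom_J t)); last first.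
  apply: (@filterS _ _ _ (~` [set chi | ev chi (dom_J t)])); first by move=> ? ? [].
  by apply: open_nbhs_nbhs; split=> //; apply: closed_openC; case: (clopen_ev (dom_J t)).
have neq : \pi_(groupoid_of r) (arrow_at Hs) != \pi_(groupoid_of r) (arrow_at Ht).
  by apply/eqP => /pi_eqP /rel_arrow_at ?; apply: nchi.
have [[A B] /= [/set_mem As /set_mem Bt] [oA oB /eqP AB]] := hG _ _ neq.
have [V [oV Vchi VA]] := (action_openP _).1 oA _ As.
have [U [oU Uchi UB]] := (action_openP _).1 oB _ Bt.
apply: (@filterS _ _ _ (V `&` U)); last first.
  by apply: open_nbhs_nbhs; split=> //; exact: openI.
move=> psi [Vpsi Upsi] [Gs Gt /(rel_arrow_at Gs Gt) /pi_eqP E].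
have : (A `&` B) (\pi_(groupoid_of r) (arrow_at Gs)).
  split; first exact: (VA (arrow_at Gs)).
  rewrite E; exact: (UB (arrow_at Gt)).
by rewrite AB.
Qed.

Lemma pfix_of_hausdorff : hausdorff_space (groupoid_of r) ->
  forall s : set (C * C), Il s -> exists E : set (set C),
    [/\ finite_set E, E `<=` K & pfix s = \bigcup_(e in E) e].
Proof.
move=> hG s Is; have [_ si] := Il_partial_bijection Is.
have Iu : Il (s^-1 \; s)%relation by apply: Il_comp => //; exact: Il_inv.
pose s' : @Il C := exist (fun s => s \in @Il C) s (mem_set Is).
pose u : @Il C := exist (fun s => s \in @Il C) _ (mem_set Iu).
have fixu : pfix ((val u)^-1 \; val s')%relation = pfix s.
  apply/seteqP; split=> x /=.
    by move=> [y /= xy [z /= xz yz]]; rewrite -(si _ _ _ xz yz) in xy.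
  by move=> xx; exists x => //=; exists x.
have cA := subclosed_compact (@closed_rel_arrow_at s' u hG) (@compact_ev C (dom_J s'))
  (fun chi '(And3 Hs _ _) => Hs).
have [||E [finE ED AE]] := @compact_finite_subcover _ _ _
  [set k | K k /\ k `<=` pfix s] (fun k => [set chi | ev_bar chi k]) cA.
- by move=> k _; exact: open_ev_bar.
- by move=> chi [_ _ [k [Kk chik]]]; rewrite fixu => ks; exists k.
exists E; split=> // [k /ED[]//|]; apply/seteqP; split=> [x sx|x [k /ED[_]]]; last exact.
(* The character of a fixed point x of s charges xC, which s fixes. *)
have [|k Ek /= chik] := AE (point_char x); last first.
  by exists k => //; apply/ev_bar_point_char => //; apply/K_Jbar; case: (ED _ Ek).
split; [|apply/ev_point_char|].
- by apply/ev_point_char; exists x.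
- by exists x; exists x.
exists (principal x); split; first exact/J_K/J_principal.
  apply/ev_bar_point_char; first exact/J_Jbar/J_principal.
  exact: mem_principal.
by rewrite fixu; exact: pfix_principal.
Qed.

End Groupoids.

Theorem lemma4p1 (C : lcCategory) :
  (hausdorff_space (groupoid C) <->
    forall s : set (C * C), Il s ->
      exists E : set (set C), [/\ finite_set E, E `<=` @J C &
        pfix s = \bigcup_(e in E) e])
  /\
  (hausdorff_space (groupoid_bar C) <->
    forall s : set (C * C), Il s ->
      exists E : set (set C), [/\ finite_set E, E `<=` @Jbar C &
        pfix s = \bigcup_(eps in E) eps]).
Proof.
have germP (p q : action_dom C) : germ_equiv C p q <-> pt p = pt q /\
    exists k, [/\ @J C k, ev_bar (pt p) k & prestr (bis p) k = prestr (bis q) k].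
  split=> [/asboolP[pq [e [pe E]]]|[pq [k [Jk pk E]]]].
    split=> //; exists (val e); split=> //; last exact/ev_bar_J.
    exact: set_mem (valP e).
  apply/asboolP; split=> //.
  exists (exist (fun A => A \in @J C) k (mem_set Jk)); split=> //.
  exact/ev_bar_J.
have germ_barP (p q : action_dom C) : germ_bar_equiv C p q <-> pt p = pt q /\
    exists k, [/\ @Jbar C k, ev_bar (pt p) k & prestr (bis p) k = prestr (bis q) k].
  by split=> [/asboolP|?] //; apply/asboolP.
have JI k e : @J C k -> @J C e -> J (k `&` e) by exact: J_setI.
have JbarI k e : @Jbar C k -> @J C e -> Jbar (k `&` e).
  by move=> Jk /J_Jbar; exact: Jbar_setI.
split; split.
- exact: (pfix_of_hausdorff (fun _ Je => Je) (@J_Jbar C) JI germP).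
- by move=> fixE; exact: (hausdorff_of_pfix (@J_Jbar C) JI germP fixE).
- exact: (pfix_of_hausdorff (@J_Jbar C) (fun _ Je => Je) JbarI germ_barP).
- by move=> fixE; exact: (hausdorff_of_pfix (fun _ Je => Je) JbarI germ_barP fixE).
Qed.
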